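(* Consider the offline multi-agent ski-rental problem with agents having active days $N_1\le\dots\le N_M$ and let $\ell_*=\min\{0\le\ell\le M-1: N_{\ell+1}>\min\{G/(M-\ell),B\}\}$. The offline policy in which each agent $m$ with $N_m\le\min\{G/(M-\ell_* ),B\}$ rents on all its active days, while the agents $\ell_*+1,\dots,M$ (those with $N_m>\min\{G/(M-\ell_* ),B\}$) buy a pass at the beginning, either the group pass shared by these $M-\ell_*$ agents or individual passes, whichever is cheaper, so that the cost of agent $m$ is $$\mathrm{OPT}^{(\mathrm{IND})}_m=\begin{cases}N_m & \text{if } N_m\le\min\left\{\frac{G}{M-\ell_*},B\right\},\\[1mm] \min\left\{\frac{G}{M-\ell_*},B\right\} & \text{if } N_m>\min\left\{\frac{G}{M-\ell_*},B\right\},\end{cases}$$ is a (general-sum) Nash equilibrium for all agents.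
   Context: Setting: $M,B,G$ are positive integers with $B<G<MB$. There are agents $m\in\{1,\dots,M\}$, agent $m$ having $N_m\in\mathbb N^+$ active days, with $N_1\le\dots\le N_M$, all known (offline setting). At the beginning each agent chooses one of three options: rent on all its active days (cost $N_m$), buy an individual pass (cost $B$), or join the group-pass purchase (cost $G/k$, where $k$ is the number of agents choosing the group option). Each agent aims to minimize its own individual cost; a Nash equilibrium is a profile of choices from which no agent can strictly decrease its own cost by a unilateral deviation. $\ell_*$ is the number of agents better off renting than buying; if the set defining $\ell_*$ is empty, $\ell_*=M$ and $G/0$ is read as $+\infty$, i.e. all agents rent. *)

(* Defs.v *)
From mathcomp Require Import all_boot all_order all_algebra.
From mathcomp Require Export constructive_ereal.

Set Implicit Arguments.
Unset Strict Implicit.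
Unset Printing Implicit Defensive.

Import Order.TTheory GRing.Theory Num.Theory.

Local Open Scope ring_scope.
Local Open Scope ereal_scope.

(* Agents are indexed from 0: [m : 'I_M] stands for agent m + 1 of the usual
   1-based numbering.  Costs live in [\bar rat] because G / 0 is read as
   +oo. *)

Inductive pass_choice := Rent | IndividualPass | GroupPass.

Definition is_group (a : pass_choice) : bool :=
  if a is GroupPass then true else false.

Definition profile (M : nat) := 'I_M -> pass_choice.

Definition group_share (G k : nat) : \bar rat :=
  if k == 0%N then +oo else (G%:R / k%:R)%:E.

Definition group_size (M : nat) (s : profile M) : nat :=
  #|[pred j | is_group (s j)]|.

Definition cost (M B G : nat) (N : 'I_M -> nat) (s : profile M) (m : 'I_M)
    : \bar rat :=
  match s m with
  | Rent => (N m)%:R%:E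
  | IndividualPass => B%:R%:E
  | GroupPass => group_share G (group_size s)
  end.

Definition deviate (M : nat) (s : profile M) (m : 'I_M) (a : pass_choice)
    : profile M :=
  fun j => if j == m then a else s j.

Definition nash_equilibrium (M : nat) (c : profile M -> 'I_M -> \bar rat)
    (s : profile M) : Prop :=
  forall (m : 'I_M) (a : pass_choice), ~ c (deviate s m a) m < c s m.

Definition pass_price (M B G l : nat) : \bar rat :=
  Order.min (group_share G (M - l)) B%:R%:E.

(* With 0-based agents, N_(l+1) is [N l]; the default value M of the big
   minimum is the convention for an empty set. *)
Definition ell_star (M B G : nat) (N : 'I_M -> nat) : nat :=
  \big[minn/M]_(l < M | pass_price M B G l < (N l)%:R%:E) (l : nat).

Definition OPT_ind (M B G : nat) (N : 'I_M -> nat) (m : 'I_M) : \bar rat :=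
  let p := pass_price M B G (ell_star B G N) in
  if (N m)%:R%:E <= p then (N m)%:R%:E else p.

(* When both kinds of pass are equally cheap, either choice, made in common by
   all the buyers, is an instance of the policy. *)
Definition offline_policy (M B G : nat) (N : 'I_M -> nat) (s : profile M)
    : Prop :=
  let l := ell_star B G N in
  let p := pass_price M B G l in
  let g := group_share G (M - l) in
  (forall m, (N m)%:R%:E <= p -> s m = Rent) /\
  ((g <= B%:R%:E /\ forall m, p < (N m)%:R%:E -> s m = GroupPass) \/
   (B%:R%:E <= g /\ forall m, p < (N m)%:R%:E -> s m = IndividualPass)).

(* Main.v *)
Require Import Defs.
From mathcomp Require Import all_boot all_order all_algebra.

Set Implicit Arguments.
Unset Strict Implicit.
Unset Printing Implicit Defensive.

Import Order.TTheory GRing.Theory Num.Theory.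

(* Write p l for [pass_price M B G l], which is nondecreasing in l.  Agents
   before ell_star miss the defining condition at their own index, so
   N_m <= p m <= p ell_star, while agents from ell_star on satisfy it by
   monotonicity of N: the policy's buyers are exactly the last M - ell_star
   agents.  The delicate deviation is a renter m < ell_star joining the
   group: it would pay G / (M - ell_star + 1) >= G / (M - m) >= p m >= N_m. *)

Lemma group_share_anti (G j k : nat) :
  (j <= k)%N -> (group_share G k <= group_share G j)%E.
Proof.
(* For [j = 0] the larger side is [+oo]; afterwards [k] is positive too and both shares are genuine
   quotients. *)
rewrite /group_share; case: j => [|j]; first by rewrite leey.
case: k => // k jk; rewrite lee_fin ler_wpM2l ?ler0n//.
by rewrite lef_pV2 ?posrE ?ltr0n// ler_nat.
Qed.

Lemma pass_price_mono (M B G j k : nat) :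
  (j <= k)%N -> (pass_price M B G j <= pass_price M B G k)%E.
Proof.
by move=> jk; apply: le_min2 => //; apply/group_share_anti/leq_sub2l.
Qed.

Lemma ell_star_le (M B G : nat) (N : 'I_M -> nat) (m : 'I_M) :
  (pass_price M B G m < (N m)%:R%:E)%E -> (ell_star B G N <= m)%N.
Proof.
move=> Pm; rewrite /ell_star -minEnat -leEnat.
exact: (bigmin_le_cond M (fun i : 'I_M => i : nat) Pm).
Qed.

(** [minn] returns one of its arguments, so the property passes through the big minimum; the left
    case is the default value of an empty range. *)
Lemma ell_star_attained (M B G : nat) (N : 'I_M -> nat) :
  ell_star B G N = M \/
  exists2 m : 'I_M, ell_star B G N = m &
    (pass_price M B G m < (N m)%:R%:E)%E.
Proof.
rewrite /ell_star; elim/big_ind: _ => [|x y Px Py|m Pm]; first by left.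
- by rewrite /minn; case: ifP.
- by right; exists m.
Qed.

Lemma group_size_deviate_group (M : nat) (s : profile M) (m : 'I_M) :
  group_size (deviate s m GroupPass) = (~~ is_group (s m) + group_size s)%N.
Proof.
rewrite /group_size -[in RHS](cardU1 m); apply: eq_card => j.
by rewrite !inE /deviate; case: eqP.
Qed.

Lemma card_ord_geq (M l : nat) : #|[pred j : 'I_M | (l <= j)%N]| = (M - l)%N.
Proof.
rewrite -sum1_card -[RHS]muln1 -sum_nat_const_nat big_geq_mkord.
exact: eq_bigl.
Qed.

Section OfflinePolicy.

Variables (M B G : nat) (N : 'I_M -> nat).
Hypothesis hBG : (B < G)%N.
Hypothesis hNmono : forall i j : 'I_M, (i <= j)%N -> (N i <= N j)%N.

Local Notation l := (ell_star B G N).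
Local Notation p := (pass_price M B G l).

Lemma renter_le_own_price (m : 'I_M) :
  (m < l)%N -> ((N m)%:R%:E <= pass_price M B G m)%E.
Proof. by rewrite leNgt ltnNge; apply/contra/ell_star_le. Qed.

Lemma buyerP (m : 'I_M) : (p < (N m)%:R%:E)%E = (l <= m)%N.
Proof.
apply/idP/idP => [|lm].
  rewrite ltNge leqNgt; apply/contra => ml.
  exact: le_trans (renter_le_own_price ml) (pass_price_mono _ _ _ (ltnW ml)).
(* If [l = M], then [l <= m] is impossible for an agent [m]. *)
have [lM|[i li Pi]] := ell_star_attained B G N.
  by move: lm; rewrite lM leqNgt ltn_ord.
rewrite li; apply: (lt_le_trans Pi); rewrite lee_fin ler_nat hNmono//.
by rewrite -li.
Qed.

Lemma renterP (m : 'I_M) : ((N m)%:R%:E <= p)%E = (m < l)%N.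
Proof. by rewrite leNgt buyerP ltnNge. Qed.

(** Keeps the equilibrium claim from being vacuous: the cheaper kind of pass, given to all agents
    from [l] on, is a witness. *)
Lemma offline_policy_exists : exists s, offline_policy B G N s.
Proof.
have := le_total (group_share G (M - l)) B%:R%:E.
case/orP => gB;
  [exists (fun m => if (m < l)%N then Rent else GroupPass)
  |exists (fun m => if (m < l)%N then Rent else IndividualPass)];
  (split=> [m|]; first by rewrite renterP => ->);
  [left|right]; split=> // m; by rewrite buyerP ltnNge => ->.
Qed.

Lemma price_le_individual : (p <= B%:R%:E)%E.
Proof. by rewrite /pass_price ge_min lexx orbT. Qed.

(** Settles the deviation that opens a group alone; this is where [B < G] enters. *)
Lemma individual_le_group1 : (B%:R%:E <= group_share G 1)%E.
Proof. by rewrite /group_share/= divr1 lee_fin ler_nat ltnW. Qed.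

(** Merges the two tie-breaking branches into one common choice [a] of the buyers, whose price is
    [p] in either case. *)
Lemma offline_policy_threshold (s : profile M) : offline_policy B G N s ->
  exists a, [/\ forall m, s m = if (m < l)%N then Rent else a,
    a = GroupPass \/ a = IndividualPass &
    (if is_group a then group_share G (M - l) else B%:R%:E) = p].
Proof.
move=> [sR [[gB sB]|[gB sB]]].
- exists GroupPass; split=> [m||]; last by rewrite /pass_price min_l.
    by case: ltnP => ml; [rewrite sR ?renterP | rewrite sB ?buyerP].
  by left.
- exists IndividualPass; split=> [m||]; last by rewrite /pass_price min_r.
    by case: ltnP => ml; [rewrite sR ?renterP | rewrite sB ?buyerP].
  by right.
Qed.

Lemma threshold_group_size (s : profile M) (a : pass_choice) :
  (forall m, s m = if (m < l)%N then Rent else a) ->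
  group_size s = (if is_group a then M - l else 0)%N.
Proof.
move=> sE; rewrite -(card_ord_geq M l) /group_size; case: ifP => Ha.
  by apply: eq_card => j; rewrite !inE sE; case: ltnP.
by apply: eq_card0 => j; rewrite !inE sE; case: ltnP.
Qed.

Lemma offline_policy_cost (s : profile M) (m : 'I_M) :
  offline_policy B G N s -> cost B G N s m = OPT_ind B G N m.
Proof.
case/offline_policy_threshold => a [sE aE pE].
rewrite /OPT_ind renterP /cost sE (threshold_group_size sE) -pE.
by case: ltnP => // _; case: aE => ->.
Qed.

Lemma OPT_ind_minE (m : 'I_M) :
  OPT_ind B G N m = Order.min (N m)%:R%:E p.
Proof. by rewrite minEle. Qed.

Lemma OPT_ind_le_rent (m : 'I_M) : (OPT_ind B G N m <= (N m)%:R%:E)%E.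
Proof. by rewrite OPT_ind_minE ge_min lexx. Qed.

Lemma OPT_ind_le_price (m : 'I_M) : (OPT_ind B G N m <= p)%E.
Proof. by rewrite OPT_ind_minE ge_min lexx orbT. Qed.

Lemma OPT_ind_le_individual (m : 'I_M) : (OPT_ind B G N m <= B%:R%:E)%E.
Proof. exact: le_trans (OPT_ind_le_price m) price_le_individual. Qed.

Lemma OPT_ind_le_group (s : profile M) (m : 'I_M) : offline_policy B G N s ->
  (OPT_ind B G N m <= group_share G (group_size (deviate s m GroupPass)))%E.
Proof.
move=> sP; rewrite group_size_deviate_group.
have [sm|sm] := boolP (is_group (s m)).
  (* A member of the group who chooses it again leaves its size, hence the cost, unchanged. *)
  by rewrite -(offline_policy_cost m sP) /cost; case: (s m) sm.
have [a [sE _ _]] := offline_policy_threshold sP.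
rewrite (threshold_group_size sE); case: ifP => [ga|_]; last first.
  (* The buyers hold individual passes, so [m] would be a group of one. *)
  exact: le_trans (OPT_ind_le_individual m) individual_le_group1.
have ml : (m < l)%N by move: sm; rewrite sE; case: ltnP => //; rewrite ga.
apply: le_trans (OPT_ind_le_rent m) _.
apply: le_trans (renter_le_own_price ml) _.
rewrite /pass_price ge_min group_share_anti// add1n.
(* [m < l] makes the enlarged group, of size [M - l + 1], at most [M - m]. *)
by rewrite ltn_sub2l.
Qed.

Lemma offline_policy_nash (s : profile M) :
  offline_policy B G N s -> nash_equilibrium (cost B G N) s.
Proof.
move=> sP m a; apply/negP; rewrite -leNgt (offline_policy_cost m sP).
(* Only the choice of [m] is unfolded; the deviated profile inside [group_size] stays folded, as
   [OPT_ind_le_group] expects. *)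
rewrite /cost {1}/deviate eqxx; case: a.
- exact: OPT_ind_le_rent.
- exact: OPT_ind_le_individual.
- exact: OPT_ind_le_group.
Qed.

End OfflinePolicy.

Theorem proposition2 (M B G : nat) (N : 'I_M -> nat)
    (hM : (0 < M)%N) (hB : (0 < B)%N) (hBG : (B < G)%N) (hGMB : (G < M * B)%N)
    (hNpos : forall m, (0 < N m)%N)
    (hNmono : forall i j : 'I_M, (i <= j)%N -> (N i <= N j)%N) :
  (forall m : 'I_M,
     (pass_price M B G (ell_star B G N) < ((N m)%:R : rat)%:E)%E
       <-> (ell_star B G N <= m)%N) /\
  (exists s : profile M, offline_policy B G N s) /\
  (forall s : profile M, offline_policy B G N s ->
     (forall m, cost B G N s m = OPT_ind B G N m) /\
     nash_equilibrium (cost B G N) s).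
Proof.
split=> [m|]; first by rewrite buyerP.
split=> [|s sP]; first exact: offline_policy_exists.
by split=> [m|]; [apply: offline_policy_cost | apply: offline_policy_nash].
Qed.
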